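(* There exist absolute constants $C, c > 0$ such that the following holds. Let $q$ be a prime power, let $k, n$ be positive integers, let $0 < \varepsilon < 1$, and let $\mathcal{C} \subseteq \mathbb{F}_q^n$ be a linear code of dimension $k$, possibly equipped with positive real coordinate weights $w = (w_1, \dots, w_n)$ (the unweighted case being $w_i = 1$ for all $i$). Then $\mathcal{C}$ has a $(1 \pm \varepsilon)$-sparsifier of size at most $$C \cdot \frac{k \log_2 q}{\varepsilon^2} \cdot \big(\log_2(4k/\varepsilon) \cdot \log_2\log_2(4q)\big)^{c}.$$ (That is, the size is $\widetilde{O}(k \log q / \varepsilon^2)$, where $\widetilde{O}$ hides factors polylogarithmic in $k$, $1/\varepsilon$ and $\log q$.)
   Context: A linear code $\mathcal{C} \subseteq \mathbb{F}_q^n$ of dimension $k$ is a $k$-dimensional $\mathbb{F}_q$-linear subspace of $\mathbb{F}_q^n$. For $v \in \mathbb{F}_q^n$, $\mathrm{wt}(v)$ is the number of nonzero coordinates of $v$; for positive weights $w$, the weighted Hamming weight is $\mathrm{wt}_w(v) = \sum_{i : v_i \neq 0} w_i$. For $S \subseteq [n]$, $v|_S = (v_i)_{i \in S}$. A $(1\pm\varepsilon)$-sparsifier of size $s$ for a (weighted) code $\mathcal{C}$ is a subset $S \subseteq [n]$ with $|S| \le s$ together with nonnegative weights $(w'_i)_{i \in S}$ such that for every codeword $v \in \mathcal{C}$, $(1-\varepsilon)\mathrm{wt}_w(v) \le \mathrm{wt}_{w'}(v|_S) \le (1+\varepsilon)\mathrm{wt}_w(v)$. *)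

(* Defs.v *)
From mathcomp Require Import all_boot all_algebra.
From Stdlib Require Import Reals.
Set Implicit Arguments. Unset Strict Implicit. Unset Printing Implicit Defensive.
Import GRing.Theory.

Definition log2 (x : R) : R := (ln x / ln 2)%R.

Definition wwt (F : fieldType) (n : nat) (w : 'I_n -> R) (v : 'rV[F]_n) : R :=
  \big[Rplus/0%R]_(i < n | v ord0 i != (GRing.zero : F)) w i.

Definition wwt_on (F : fieldType) (n : nat) (S : {set 'I_n}) (w' : 'I_n -> R)
    (v : 'rV[F]_n) : R :=
  \big[Rplus/0%R]_(i in S | v ord0 i != (GRing.zero : F)) w' i.

Definition is_sparsifier (F : fieldType) (n : nat) (Cd : {vspace 'rV[F]_n})
    (w : 'I_n -> R) (eps s : R) (S : {set 'I_n}) (w' : 'I_n -> R) : Prop :=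
  (INR #|S| <= s)%R /\
  (forall i, i \in S -> (0 <= w' i)%R) /\
  (forall v, v \in Cd ->
     ((1 - eps) * wwt w v <= wwt_on S w' v)%R /\
     (wwt_on S w' v <= (1 + eps) * wwt w v)%R).

(* Main.v *)
(* A code of dimension k is split into levels in the manner of the strength decomposition
   of Benczur and Karger. Peeling off, again and again, a subcode D of least density
   w(supp D) / dim D assigns to each coordinate a strength d_e, and u_e = w_e / d_e has
   total mass at most k. With respect to u each level E of the decomposition is dense:
   the restriction of the code to E has no subcode D with u(supp D) < dim D. Karger's
   contraction argument then bounds the number of words of u-weight at most a on a level
   by (q k)^a, so that independent sampling with probabilities min(1, rho u_e), where
   rho is of order log(q k) / eps^2, preserves simultaneously the u-weight of all words
   on all of the at most k levels; w is a nonnegative combination of the levels of u. *)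
From mathcomp Require Import all_boot all_order all_algebra.
From mathcomp Require Import all_field.
From mathcomp Require Import ring lra zify.
From mathcomp Require Import Rstruct.
Set Implicit Arguments. Unset Strict Implicit. Unset Printing Implicit Defensive.
Import Order.TTheory GRing.Theory Num.Theory.
Local Open Scope ring_scope.

(** * Strength decomposition for a submodular rank function *)

(** For the rank function of a code, [r E - r A] is the dimension of the space of words on [E] that
    vanish on [A], and these are supported in [E :\: A]. Phrasing density by ranks keeps codes out
    of the decomposition. *)
Definition dense (K : realFieldType) (I : finType) (r : {set I} -> nat)
    (u : I -> K) (E : {set I}) : Prop :=
  forall A : {set I}, A \subset E ->
    (r E)%:R - (r A)%:R <= \sum_(e in E :\: A) u e.

Lemma sumr_setD (V : zmodType) (I : finType) (u : I -> V) (E A : {set I}) :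
  A \subset E ->
  \sum_(e in E) u e = \sum_(e in A) u e + \sum_(e in E :\: A) u e.
Proof. by move=> /setIidPr AE; rewrite (big_setID A) /= AE. Qed.

(* An entry (E_j, delta_j) of L is a level and the increment of the strength on entering
   it: the strength of e is d0 plus the sum of the delta_j over the levels containing e.
   The lower bound d0 on the densities is what the induction carries from one level to the
   next; a coordinate of rank 0 has no strength. *)
Lemma strength_decomposition (K : realFieldType) (I : finType)
    (r : {set I} -> nat) (w : I -> K) :
  r set0 = 0%N -> {homo r : A B / A \subset B >-> (A <= B)%N} ->
  (forall A B, r (A :|: B) + r (A :&: B) <= r A + r B)%N ->
  (forall e, 0 < w e) ->
  forall (E : {set I}) (d0 : K),
  (forall A : {set I}, A \subset E ->
    d0 * ((r E)%:R - (r A)%:R) <= \sum_(e in E :\: A) w e) ->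
  exists (u : I -> K) (L : seq ({set I} * K)),
  [/\ forall e, 0 <= u e,
      \sum_(e in E) u e <= (r E)%:R /\ dense r u E,
      (size L <= r E)%N,
      forall p, p \in L -> [/\ 0 <= p.2, p.1 \subset E, dense r u p.1 &
        \sum_(e in p.1) u e <= (r p.1)%:R] &
      forall e, e \in E -> r [set e] <> 0%N ->
        w e = u e * (d0 + \sum_(p <- L | e \in p.1) p.2)].
Proof.
move=> r0 rmono rsub w_gt0 E.
have [m] := ubnP (r E); elim: m E => // m IH E rEm d0 d0E.
have [rE0|rE_gt0] := posnP (r E).
  exists (fun=> 0), [::]; split=> //.
  - split; first by rewrite big1 ?ler0n.
    by move=> A _; rewrite rE0 big1// sub0r oppr_le0 ler0n.
  - move=> e eE; case.
    by have := rmono [set e] E; rewrite sub1set rE0 leqn0 => /(_ eE)/eqP.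
pose P (A : {set I}) := (A \subset E) && (r A < r E)%N.
(* The density of the subcode of words vanishing on [A]. The minimizer [T] is kept for the
   induction, and the coordinates of [E :\: T] receive strength [d]. *)
pose f (A : {set I}) := (\sum_(e in E :\: A) w e) / ((r E)%:R - (r A)%:R).
have P0 : P set0 by rewrite /P sub0set r0.
case: (@arg_minP _ K _ set0 P f P0) => T /andP[TE rTE] fmin.
set d := f T in fmin *.
have rpos (A : {set I}) : P A -> 0 < (r E)%:R - (r A)%:R :> K.
  by case/andP=> _; rewrite subr_gt0 ltr_nat.
have PT : P T by rewrite /P TE.
have dT : \sum_(e in E :\: T) w e = d * ((r E)%:R - (r T)%:R).
  by rewrite /d /f divfK// gt_eqF// rpos.
have dE (A : {set I}) : A \subset E ->
    d * ((r E)%:R - (r A)%:R) <= \sum_(e in E :\: A) w e.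
  move=> AE; have [rAE|rAE] := ltnP (r A) (r E).
    by rewrite -ler_pdivlMr ?rpos ?fmin// /P AE rAE.
  have -> : r A = r E by apply/eqP; rewrite eqn_leq rAE rmono.
  by rewrite subrr mulr0 sumr_ge0// => e _; rewrite ltW.
have d0d : d0 <= d by rewrite ler_pdivlMr ?rpos// d0E.
have d_gt0 : 0 < d.
  rewrite divr_gt0 ?rpos// lt_def sumr_ge0 ?andbT; last by move=> e _; rewrite ltW.
  have /set0Pn[x xET] : E :\: T != set0.
    by rewrite setD_eq0; apply: contraTN rTE => /rmono; rewrite -leqNgt.
  rewrite (bigD1 x)//= gt_eqF// ltr_wpDr// sumr_ge0// => e _; exact: ltW.
(* Subtracting the equality [dT] from the bound [dE] leaves density at least [d] inside [T], so
   strengths only grow on the way in. *)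
have [||u [L [u_ge0 [uT duT] sL LT wL]]] := IH T _ d.
- exact: leq_trans rTE _.
- move=> A AT; have AE := subset_trans AT TE.
  have := dE A AE; rewrite (sumr_setD w (setDS E AT)) dT.
  have -> : (E :\: A) :\: (E :\: T) = T :\: A.
    apply/setP => e; rewrite !inE.
    have /implyP := subsetP TE e; have /implyP := subsetP AT e.
    by case: (e \in A); case: (e \in T); case: (e \in E).
  lra.
pose u' e := if e \in T then u e else w e / d.
have u'T (A : {set I}) : A \subset T -> \sum_(e in A) u' e = \sum_(e in A) u e.
  by move=> /subsetP AT; apply: eq_bigr => e /AT; rewrite /u' => ->.
have u'C (A : {set I}) : [disjoint A & T] ->
    \sum_(e in A) u' e = (\sum_(e in A) w e) / d.
  move=> AT; rewrite mulr_suml; apply: eq_bigr => e eA.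
  by rewrite /u' (disjointFr AT eA).
exists u', ((E, d - d0) :: L).
have u'E : \sum_(e in E) u' e <= (r E)%:R.
  rewrite (sumr_setD _ TE) u'T// u'C; last first.
    by rewrite -setI_eq0 setIDAC setDIl setDv setI0.
  by rewrite dT mulrAC divff ?gt_eqF// mul1r; lra.
have du'E : dense r u' E.
  (* The density of [T] bounds the mass of [T :\: A], and the minimality of [d], applied to
     [A :|: T], bounds the rest; submodularity adds up the two rank drops. *)
  move=> A AE; rewrite (@sumr_setD _ _ _ _ (T :\: A)) ?setSD//.
  rewrite u'T ?subsetDl// u'C; last first.
    rewrite -setI_eq0; apply/eqP/setP => e; rewrite !inE.
    by case: (e \in A); case: (e \in T); rewrite ?andbF.
  have := duT (A :&: T) (subsetIr _ _).
  have -> : T :\: (A :&: T) = T :\: A by rewrite setDIr setDv setU0.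
  have := dE (A :|: T); rewrite subUset AE TE => /(_ isT).
  have -> : E :\: (A :|: T) = (E :\: A) :\: (T :\: A).
    by apply/setP => e; rewrite !inE; case: (e \in A); case: (e \in T).
  rewrite mulrC -ler_pdivlMr//.
  have := rsub A T; rewrite -(ler_nat K) !natrD; lra.
split=> //.
- by move=> e; rewrite /u'; case: ifP => // _; rewrite divr_ge0 ?ltW.
- exact: leq_ltn_trans sL _.
- move=> p; rewrite inE => /predU1P[->|/LT[p2 pT dup upr]] /=.
    by split; rewrite ?subr_ge0.
  split=> //; first exact: subset_trans pT TE.
    move=> A Ap; rewrite u'T; first exact: dup.
    exact: subset_trans (subsetDl _ _) pT.
  by rewrite u'T.
- move=> e eE re0; rewrite big_cons /= eE.
  case: (boolP (e \in T)) => eT; rewrite /u'.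
    by rewrite eT (wL e eT re0); congr (_ * _); rewrite addrA; congr (_ + _); ring.
  rewrite (negPf eT) big_seq_cond big1 => [|p /andP[/LT[_ /subsetP pT _ _] /pT]]; last first.
    by rewrite (negPf eT).
  by rewrite addr0 addrC subrK divfK// gt_eqF.
Qed.

(** * Restrictions of a code and their ranks *)

Section Restriction.
Context {F : fieldType} {n : nat}.
Implicit Types (E A B : {set 'I_n}) (C D : {vspace 'rV[F]_n}).

(** Restriction is encoded as zeroing the other coordinates, so that all restrictions live in one
    ambient space. *)
Definition mask E : 'End('rV[F]_n) :=
  linfun (mulmxr (diag_mx (\row_j (j \in E)%:R))).

Lemma maskE E (v : 'rV[F]_n) j : mask E v ord0 j = if j \in E then v ord0 j else 0.
Proof.
by rewrite lfunE /= mul_mx_diag !mxE; case: ifP => _; rewrite ?mulr1 ?mulr0.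
Qed.

Lemma mask_comp A E : (mask A \o mask E)%VF = mask (A :&: E).
Proof.
apply/lfunP => v; apply/rowP => j; rewrite comp_lfunE !maskE inE.
by case: (j \in A).
Qed.

Lemma mask_limg A E C : A \subset E -> (mask A @: (mask E @: C))%VS = (mask A @: C)%VS.
Proof. by move=> /setIidPl AE; rewrite -limg_comp mask_comp AE. Qed.

(** The rank function of the matroid represented by the columns of a generator matrix of [C]. *)
Definition code_rank C E : nat := \dim (mask E @: C).

Lemma code_rank0 C : code_rank C set0 = 0%N.
Proof.
apply/eqP; rewrite dimv_eq0 -subv0; apply/subvP => _ /memv_imgP[v _ ->].
by rewrite memv0; apply/eqP/rowP => j; rewrite maskE inE mxE.
Qed.

Lemma code_rankS C : {homo code_rank C : A B / A \subset B >-> (A <= B)%N}.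
Proof.
by move=> A B AB; rewrite /code_rank -(mask_limg C AB)
  -(limg_ker_dim (mask A) (mask B @: C)) leq_addl.
Qed.

Lemma code_rank_le C E : (code_rank C E <= \dim C)%N.
Proof. by rewrite -(limg_ker_dim (mask E) C) leq_addl. Qed.

(** A word of the restriction to [A :|: B] that vanishes on [B] is a word of the restriction to [A]
    that vanishes on [A :&: B]. Rank-nullity turns this inclusion of kernels into the inequality. *)
Lemma code_rank_submod C A B :
  (code_rank C (A :|: B) + code_rank C (A :&: B) <= code_rank C A + code_rank C B)%N.
Proof.
rewrite /code_rank.
have := limg_ker_dim (mask B) (mask (A :|: B) @: C).
have := limg_ker_dim (mask (A :&: B)) (mask A @: C).
rewrite !mask_limg ?subsetUr ?subsetIl// => <- <-.
rewrite -!addnA [X in (_ <= _ + X)%N]addnC leq_add2r.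
apply/dimvS/subvP => _ /memv_capP[/memv_imgP[v vC ->]].
rewrite !memv_ker => /eqP Bv0.
have vB j : j \in B -> v ord0 j = 0.
  by move=> jB; move/rowP/(_ j): Bv0; rewrite !maskE inE jB orbT mxE.
have -> : mask (A :|: B) v = mask A v.
  apply/rowP => j; rewrite !maskE inE.
  by case: (boolP (j \in A)) => //= _; case: ifP => // /vB.
rewrite memv_cap memv_img//= memv_ker; apply/eqP/rowP => j.
by rewrite !maskE !inE mxE; case: ifP => // /andP[-> /vB].
Qed.

End Restriction.

(** * Counting words of small weight *)

Definition wgt (K : zmodType) (F : fieldType) n (u : 'I_n -> K) (v : 'rV[F]_n) : K :=
  \sum_(e < n | v ord0 e != 0) u e.

Section Counting.
Context {F : finFieldType} {n : nat}.
Implicit Types (C D : {vspace 'rV[F]_n}).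

Definition csupp D : {set 'I_n} :=
  [set e | [exists v : 'rV[F]_n, (v \in D) && (v ord0 e != 0)]].

Lemma csuppP D e : reflect (exists2 v, v \in D & v ord0 e != 0) (e \in csupp D).
Proof.
rewrite inE; apply: (iffP existsP) => [[v /andP[]]|[v vD ve]]; first by exists v.
by exists v; rewrite vD.
Qed.

Lemma mem_csupp D v e : v \in D -> v ord0 e != 0 -> e \in csupp D.
Proof. by move=> vD ve; apply/csuppP; exists v. Qed.

(** Density is applied to the complement of the support: [D] lies in the kernel of the restriction
    to it, so its dimension is at most the rank drop. *)
Lemma dense_subcode (K : realFieldType) (u : 'I_n -> K) C (E : {set 'I_n}) D :
  dense (code_rank C) u E -> (D <= mask E @: C)%VS ->
  (\dim D)%:R <= \sum_(e in csupp D) u e.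
Proof.
move=> du DE.
have sE : csupp D \subset E.
  apply/subsetP => e /csuppP[v /(subvP DE)/memv_imgP[v' _ ->]].
  by rewrite maskE; case: ifP => //; rewrite eqxx.
have := du (E :\: csupp D) (subsetDl _ _).
rewrite setDDr setDv set0U (setIidPr sE); apply: le_trans.
rewrite lerBrDr -natrD ler_nat.
rewrite /code_rank -(mask_limg C (subsetDl E (csupp D))).
rewrite -(limg_ker_dim (mask (E :\: csupp D)) (mask E @: C)) leq_add2r.
apply/dimvS; rewrite subv_cap DE; apply/subvP => v vD; rewrite memv_ker.
apply/eqP/rowP => j; rewrite maskE !inE mxE; case: ifP => // /andP[+ _].
by apply: contraNeq => vj; have := mem_csupp vD vj; rewrite inE.
Qed.

Definition light_words (K : realFieldType) (u : 'I_n -> K) (a : nat) D :=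
  [set v in D | wgt u v <= a%:R].

(* Karger's contraction, averaged: killing a coordinate e chosen with probability
   proportional to u e costs one dimension, and destroys a given word of weight
   at most a with probability at most a / m, where m = \dim D. *)
Lemma card_light_words (K : realFieldType) (u : 'I_n -> K) (a m : nat) D :
  (forall e, 0 <= u e) -> (a <= m)%N -> (\dim D <= m)%N ->
  (forall D', (D' <= D)%VS -> (\dim D')%:R <= \sum_(e in csupp D') u e) ->
  (#|light_words u a D| <= #|F| ^ a * 'C(m, a))%N.
Proof.
move=> u_ge0; elim: m D => [|m IH] D am Dm dD.
  move: am; rewrite leqn0 => /eqP->; rewrite bin0 muln1 expn0.
  move: Dm; rewrite leqn0 dimv_eq0 => /eqP->.
  rewrite (leq_trans (subset_leq_card (_ : _ \subset [set 0]))) ?cards1//.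
  by apply/subsetP => v; rewrite !inE memv0 => /andP[].
move: am; rewrite leq_eqVlt => /predU1P[->|]; last rewrite ltnS => am.
  rewrite binn muln1.
  apply: (@leq_trans #|D|).
    by apply/subset_leq_card/subsetP => v; rewrite inE => /andP[].
  by rewrite card_vspace leq_exp2l// finNzRing_gt1.
have [Dm'|mD] := leqP (\dim D) m.
  by apply: leq_trans (IH D am Dm' dD) _; rewrite leq_mul2l leq_bin2l ?orbT.
have {mD Dm} Dm : \dim D = m.+1 by apply/eqP; rewrite eqn_leq Dm.
set N := #|_|; pose U := \sum_(e in csupp D) u e.
pose De e := (D :&: lker (mask [set e]))%VS.
have DeE e v : (v \in De e) = (v \in D) && (v ord0 e == 0).
  rewrite memv_cap memv_ker; congr (_ && _); apply/eqP/eqP => [/rowP/(_ e)|ve].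
    by rewrite maskE inE eqxx mxE.
  by apply/rowP => j; rewrite maskE inE mxE; case: eqP => // ->.
have NDe e : e \in csupp D ->
    (#|light_words u a (De e)| <= #|F| ^ a * 'C(m, a))%N.
  case/csuppP => v vD ve; apply: IH => //; last first.
    by move=> D' D'D; apply: dD; apply: subv_trans D'D (capvSl _ _).
  rewrite -ltnS -Dm; have := capvSl D (lker (mask [set e])); rewrite -/(De e) => DeD.
  rewrite ltn_neqAle dimvS// andbT; apply: contra ve => /eqP dDe.
  have : v \in De e by have /eqP-> : De e == D by rewrite eqEdim DeD dDe /=.
  by rewrite DeE => /andP[].
set B := (_ * _)%N in NDe.
have UB : \sum_(e in csupp D) u e * (#|light_words u a (De e)|)%:R <= U * B%:R.
  rewrite mulr_suml; apply: ler_sum => e eD.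
  by rewrite ler_wpM2l// ler_nat NDe.
have Um : m.+1%:R <= U by rewrite -Dm dD.
(* Double counting of pairs of a light word and a coordinate where it vanishes: a word [v] survives
   with total mass [U - wgt u v]. *)
have sumE : \sum_(e in csupp D) u e * (#|light_words u a (De e)|)%:R =
    \sum_(v in light_words u a D) (U - wgt u v).
  transitivity (\sum_(e in csupp D)
      \sum_(v in light_words u a D) (if v ord0 e == 0 then u e else 0)).
    apply: eq_bigr => e _; rewrite -big_mkcondr /= mulr_natr -sumr_const.
    by apply: eq_bigl => v; rewrite !inE DeE andbAC.
  rewrite exchange_big; apply: eq_bigr => v; rewrite inE => /andP[vD _].
  apply/eqP; rewrite eq_sym subr_eq /wgt.
  rewrite /U (bigID (fun e => v ord0 e == 0)) /= -big_mkcondr; apply/eqP; congr (_ + _).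
  apply: eq_bigl => e; case: eqP => /=; rewrite ?andbF// => /eqP ve.
  by rewrite andbT (mem_csupp vD ve).
have {UB sumE} UN : (U - a%:R) * N%:R <= U * B%:R.
  apply: le_trans UB; rewrite sumE mulr_natr -sumr_const; apply: ler_sum => v.
  by rewrite inE => /andP[_ va]; rewrite lerD2l lerN2.
(* [U] may be lowered to [m.+1]: the inequality reads [U * (N - B) <= a * N], and its left side
   grows with [U] when [N] exceeds [B]; otherwise the claim is immediate. *)
have : (m.+1%:R - a%:R) * N%:R <= m.+1%:R * B%:R :> K.
  have N0 : 0 <= N%:R :> K by [].
  have a0 : 0 <= a%:R :> K by [].
  have m0 : 0 <= m.+1%:R :> K by [].
  have aN := mulr_ge0 a0 N0.
  have [NB|BN] := lerP N%:R (B%:R : K); first by have := ler_wpM2l m0 NB; lra.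
  have NB0 : 0 <= N%:R - B%:R :> K by rewrite subr_ge0 ltW.
  by have := ler_wpM2r NB0 Um; lra.
rewrite -natrB; last exact: leqW.
rewrite -!natrM ler_nat /B mulnCA.
have := mul_bin_down m.+1 a; rewrite /= => ->.
by rewrite mulnCA leq_pmul2l// subn_gt0 ltnS.
Qed.

End Counting.

Lemma bin_leq_exp m a : ('C(m, a) <= m ^ a)%N.
Proof.
apply: (@leq_trans (m ^_ a)); first by rewrite -bin_ffact leq_pmulr ?fact_gt0.
elim: a => [|a IH]; first by rewrite ffactn0.
by rewrite ffactnSr expnSr leq_mul ?leq_subr.
Qed.

(** * An abstract exponential on an ordered field *)

Section Exponential.
Context {K : realFieldType} {exp : K -> K}.
Context (expD : forall x y, exp (x + y) = exp x * exp y)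
  (exp_ge1Dx : forall x, 1 + x <= exp x).
Implicit Types x y : K.

(** Each value is the square of the value at [x / 2]; a zero value would make [exp 0] vanish,
    against [1 <= exp 0]. *)
Lemma exp_gt0 x : 0 < exp x.
Proof.
have exp_ge0 y : 0 <= exp y.
  by have -> : y = y / 2 + y / 2; [lra | rewrite expD -expr2 sqr_ge0].
rewrite lt_def exp_ge0 andbT; apply: contra_leN (lexx 0) => /eqP x0.
have := exp_ge1Dx 0; rewrite -[in exp _](subrr x) expD x0 mul0r; lra.
Qed.

Lemma exp0 : exp 0 = 1.
Proof.
by apply: (mulfI (lt0r_neq0 (exp_gt0 0))); rewrite -expD addr0 mulr1.
Qed.

Lemma expN x : exp (- x) = (exp x)^-1.
Proof.
apply: (mulfI (lt0r_neq0 (exp_gt0 x))).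
by rewrite -expD subrr exp0 divff// lt0r_neq0// exp_gt0.
Qed.

Lemma ltr_exp x y : x < y -> exp x < exp y.
Proof.
move=> xy; have -> : y = x + (y - x) by ring.
rewrite expD -[ltLHS]mulr1 ltr_pM2l ?exp_gt0//.
have := exp_ge1Dx (y - x); lra.
Qed.

Lemma ler_exp x y : (exp x <= exp y) = (x <= y).
Proof.
apply/idP/idP => [|]; last by rewrite le_eqVlt => /predU1P[->//|/ltr_exp/ltW].
by apply: contraLR; rewrite -!ltNge; apply: ltr_exp.
Qed.

Lemma exp_lt1 x : exp x < 1 -> x < 0.
Proof. by rewrite -exp0 !ltNge ler_exp. Qed.

(** Inverting [1 - x <= exp (- x)] gives [exp x <= 1 / (1 - x)], which the quadratic dominates up to
    [1 / 2]. *)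
Lemma exp_le_quadratic x : x <= 1 / 2 -> exp x <= 1 + x + 2 * x ^+ 2.
Proof.
move=> x2; have x1 : 0 < 1 - x by lra.
have e1 : (1 - x) * exp x <= 1.
  rewrite -ler_pdivlMr ?exp_gt0// div1r -expN; exact: exp_ge1Dx.
rewrite -(ler_pM2l x1); apply: le_trans e1 _.
have -> : (1 - x) * (1 + x + 2 * x ^+ 2) = 1 + x ^+ 2 * (1 - 2 * x) by ring.
by rewrite lerDl mulr_ge0 ?sqr_ge0//; lra.
Qed.

Lemma exp_sum (I : finType) (P : pred I) (f : I -> K) :
  exp (\sum_(i | P i) f i) = \prod_(i | P i) exp (f i).
Proof. by apply: (big_morph _ _ exp0) => x y; rewrite expD. Qed.

(** * Independent sampling and Chernoff bounds *)

Section Sampling.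
Context {I : finType}.

Definition bernoulli (p : I -> K) (S : {set I}) : K :=
  \prod_e (if e \in S then p e else 1 - p e).

(** Independence in the form of a distributive law; [x = 1] gives total mass one, exponentials give
    moment generating functions. *)
Lemma bernoulli_prod (p x : I -> K) :
  \sum_(S : {set I}) bernoulli p S * \prod_(e in S) x e =
  \prod_e (1 + p e * (x e - 1)).
Proof.
transitivity (\prod_e (p e * x e + (1 - p e))); last by apply: eq_bigr => e _; lra.
rewrite (bigA_distr _ _ (fun e => p e * x e)); apply: eq_bigr => S _.
rewrite /bernoulli [X in _ * X]big_mkcond -big_split /=; apply: eq_bigr => e _.
by case: ifP => _; rewrite ?mulr1.
Qed.

Lemma bernoulli_mean (p : I -> K) (f : {set I} -> K) c :
  (forall e, 0 <= p e <= 1) ->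
  \sum_(S : {set I}) bernoulli p S * f S < c -> exists S, f S < c.
Proof.
move=> p01 fc; apply/existsP; apply: contraLR fc.
rewrite negb_exists -leNgt => /forallP fge.
have -> : c = \sum_(S : {set I}) bernoulli p S * c.
  rewrite -mulr_suml -[LHS]mul1r; congr (_ * _).
  transitivity (\sum_(S : {set I}) bernoulli p S * \prod_(e in S) 1).
    rewrite bernoulli_prod big1// => e _; lra.
  by apply: eq_bigr => S _; rewrite big1_eq mulr1.
apply: ler_sum => S _; apply: ler_wpM2l; last by rewrite leNgt fge.
apply: prodr_ge0 => e _; have /andP[p0 p1] := p01 e.
by case: ifP; rewrite ?subr_ge0.
Qed.

(* One factor of the moment generating function of the sample with inclusion
   probability min(1, rho u) and importance weight max(u, 1 / rho). *)
Lemma chernoff_factor (u rho eta : K) : 0 <= u -> 0 < rho -> eta <= 1 / 2 ->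
  1 + Num.min 1 (rho * u) * (exp (rho * eta * Num.max u rho^-1) - 1) <=
  exp (rho * u * (eta + 2 * eta ^+ 2)).
Proof.
move=> u0 rho0 eta2; have ru0 : 0 <= rho * u by rewrite mulr_ge0// ltW.
have e2 : 0 <= eta ^+ 2 by rewrite sqr_ge0.
(* In the first case the element is taken with certainty at weight [u]; in the second its exponent
   is exactly [eta], within reach of the quadratic bound. *)
case: (leP 1 (rho * u)) => ru.
  rewrite mul1r addrC subrK; have -> : Num.max u rho^-1 = u.
    by apply/max_idPl; rewrite -[rho^-1]mulr1 ler_pdivrMl.
  rewrite ler_exp mulrAC ler_wpM2l//; lra.
have -> : Num.max u rho^-1 = rho^-1.
  by apply/max_idPr; rewrite -[rho^-1]mulr1 ler_pdivlMl// ltW.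
have -> : rho * eta * rho^-1 = eta by rewrite mulrAC divff ?gt_eqF// mul1r.
apply: le_trans (exp_ge1Dx _) _; rewrite ler_exp ler_wpM2l//.
have := exp_le_quadratic eta2; lra.
Qed.

(** A union bound by averaging: the potential [Phi] adds the size test (mean at most 1/4) to both
    tail tests of every set (total mean at most 1/2). Some outcome has [Phi] below 1, hence every
    test below 1, that is, every exponent negative. *)
Lemma sampling (u : I -> K) (rho eps : K) (tests : seq {set I}) :
  (forall e, 0 <= u e) -> 0 < rho -> 0 < eps <= 1 ->
  \sum_(V <- tests) exp (- (rho * eps ^+ 2 / 8) * \sum_(e in V) u e) <= 1 / 4 ->
  exists S : {set I}, #|S|%:R <= 2 * (rho * \sum_e u e + 2) /\
  forall V, V \in tests ->
    (1 - eps) * \sum_(e in V) u e <= \sum_(e in S | e \in V) Num.max (u e) rho^-1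
      <= (1 + eps) * \sum_(e in V) u e.
Proof.
move=> u0 rho0 /andP[eps0 eps1] sum14.
pose p e := Num.min 1 (rho * u e); pose x e := Num.max (u e) rho^-1.
have p01 e : 0 <= p e <= 1.
  by rewrite le_min ler01 ge_min lexx /= mulr_ge0// ltW.
pose X (S V : {set I}) := \sum_(e in S | e \in V) x e.
pose U (V : {set I}) := \sum_(e in V) u e.
pose M := rho * \sum_e u e + 2.
(* One formula serves both tails: [eta = eps / 4] tests the upper bound and [eta = - (eps / 4)] the
   lower one. *)
pose test eta S V := exp (rho * eta * (X S V - (1 + 4 * eta) * U V)).
pose Ebern (f : {set I} -> K) := \sum_S bernoulli p S * f S.
have Etest eta V : eta <= 1 / 2 ->
    Ebern (test eta ^~ V) <= exp (- (2 * rho * eta ^+ 2) * U V).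
  move=> eta2.
  have testE S : test eta S V = exp (- (rho * eta * (1 + 4 * eta) * U V)) *
      \prod_(e in S) exp (if e \in V then rho * eta * x e else 0).
    rewrite -exp_sum -expD /test; congr exp.
    rewrite -big_mkcondr -mulr_sumr -/(X S V); lra.
  rewrite /Ebern; under eq_bigr do rewrite testE mulrCA.
  rewrite -mulr_sumr bernoulli_prod.
  have -> : - (2 * rho * eta ^+ 2) * U V = - (rho * eta * (1 + 4 * eta) * U V) +
     \sum_e (if e \in V then rho * u e * (eta + 2 * eta ^+ 2) else 0).
    rewrite -big_mkcond -mulr_suml -mulr_sumr -/(U V); lra.
  rewrite expD ler_pM2l ?exp_gt0// exp_sum; apply: ler_prod => e _.
  have pe := p01 e; case: ifP => eV; last by rewrite exp0 subrr mulr0 addr0 ler01 lexx.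
  rewrite chernoff_factor// andbT.
  have := exp_gt0 (rho * eta * x e); move: pe => /andP[pe0 pe1] ex0.
  by have := mulr_ge0 pe0 (ltW ex0); lra.
(* Since [exp (1 / 2) <= 2], the mean of [exp (#|S| / 2)] is at most [exp (rho * \sum_e u e)]; the
   extra 2 in [M] leaves [exp (- 2) <= 1 / 4]. *)
pose size_test (S : {set I}) := exp (#|S|%:R / 2 - M).
have Esize : Ebern size_test <= 1 / 4.
  have sizeE S : size_test S = exp (- M) * \prod_(e in S) exp (1 / 2).
    by rewrite -exp_sum -expD /size_test sumr_const -mulr_natl; congr exp; lra.
  rewrite /Ebern; under eq_bigr do rewrite sizeE mulrCA.
  rewrite -mulr_sumr bernoulli_prod.
  have e12 : exp (1 / 2) <= 2.
    by apply: le_trans (exp_le_quadratic (lexx _)) _; lra.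
  have : \prod_e (1 + p e * (exp (1 / 2) - 1)) <= exp (\sum_e rho * u e).
    rewrite exp_sum; apply: ler_prod => e _; have /andP[p0 p1] := p01 e.
    have e1 := exp_ge1Dx (1 / 2).
    have pe : 0 <= p e * (exp (1 / 2) - 1) <= p e.
      by rewrite mulr_ge0/= ?ler_piMr//; lra.
    apply/andP; split; first by lra.
    apply: le_trans (exp_ge1Dx (rho * u e)).
    have : p e <= rho * u e by rewrite ge_min lexx orbT.
    lra.
  move=> /(ler_wpM2l (ltW (exp_gt0 (- M))))/le_trans; apply.
  rewrite -expD -mulr_sumr /M opprD addrAC addNr add0r expN.
  have : 1 + 1 <= exp 1 by exact: exp_ge1Dx.
  have -> : exp 2 = exp 1 * exp 1 by rewrite -expD.
  move=> e2; rewrite div1r lef_pV2 ?posrE ?mulr_gt0 ?exp_gt0//.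
  nra.
pose Phi S := size_test S + \sum_(V <- tests) (test (eps / 4) S V + test (- (eps / 4)) S V).
have [|S PhiS] := @bernoulli_mean p Phi 1 p01.
  have -> : \sum_S bernoulli p S * Phi S = Ebern size_test +
     \sum_(V <- tests) (Ebern (test (eps / 4) ^~ V) + Ebern (test (- (eps / 4)) ^~ V)).
    rewrite /Ebern; under eq_bigr do rewrite mulrDr mulr_sumr.
    rewrite big_split /= exchange_big /=; congr (_ + _); apply: eq_bigr => V _.
    by rewrite -big_split /=; apply: eq_bigr => S _; rewrite mulrDr.
  have : \sum_(V <- tests) (Ebern (test (eps / 4) ^~ V) + Ebern (test (- (eps / 4)) ^~ V))
      <= 2 * \sum_(V <- tests) exp (- (rho * eps ^+ 2 / 8) * \sum_(e in V) u e).
    rewrite mulr_sumr; apply: ler_sum => V _.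
    have h1 : eps / 4 <= 1 / 2 by lra.
    have h2 : - (eps / 4) <= 1 / 2 by lra.
    have := lerD (Etest _ V h1) (Etest _ V h2).
    have -> : - (2 * rho * (eps / 4) ^+ 2) = - (rho * eps ^+ 2 / 8) by lra.
    have -> : - (2 * rho * (- (eps / 4)) ^+ 2) = - (rho * eps ^+ 2 / 8) by lra.
    by rewrite -/(U V); lra.
  lra.
have tests0 : 0 <= \sum_(V <- tests) (test (eps / 4) S V + test (- (eps / 4)) S V).
  by apply: sumr_ge0 => V _; rewrite addr_ge0// ltW ?exp_gt0.
exists S; split.
  have /exp_lt1 : size_test S < 1 by apply: le_lt_trans PhiS; rewrite /Phi lerDl.
  rewrite -/M; lra.
move=> V Vt; have sumS : test (eps / 4) S V + test (- (eps / 4)) S V < 1.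
  apply: le_lt_trans PhiS; rewrite /Phi (big_rem V)//=.
  rewrite addrCA lerDl addr_ge0 ?(ltW (exp_gt0 _))//.
  by apply: sumr_ge0 => W _; rewrite addr_ge0// ltW ?exp_gt0.
have r4 : 0 < rho * (eps / 4) by rewrite mulr_gt0//; lra.
have /exp_lt1 : test (eps / 4) S V < 1.
  by apply: le_lt_trans sumS; rewrite lerDl ltW ?exp_gt0.
have /exp_lt1 : test (- (eps / 4)) S V < 1.
  by apply: le_lt_trans sumS; rewrite lerDr ltW ?exp_gt0.
rewrite mulrN mulNr oppr_lt0 (pmulr_rlt0 _ r4) (pmulr_rgt0 _ r4).
rewrite -/(U V) -/(X S V) => h1 h2; apply/andP; split; lra.
Qed.

End Sampling.

(** * Sparsifiers of linear codes over an ordered field *)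

Section CodeSparsifier.
Context {F : finFieldType} {n : nat}.
Local Notation q := #|F|.

(** Words are sorted by integer layers of weight [a] from 1 to [k]. Layer [a] contributes at most
    the [a]-th power of [(q * k) ^ 2 / exp b], a ratio at most 1, hence at most the ratio itself. *)
Lemma partition_bound (u : 'I_n -> K) (D : {vspace 'rV[F]_n}) (k : nat) (b : K) :
  (forall e, 0 <= u e) -> (0 < k)%N -> (\dim D <= k)%N ->
  (forall D', (D' <= D)%VS -> (\dim D')%:R <= \sum_(e in csupp D') u e) ->
  (forall v, v \in D -> wgt u v <= k%:R) ->
  0 <= b -> ((q * k) ^ 2)%:R <= exp b ->
  \sum_(v : 'rV[F]_n | (v \in D) && (v != 0)) exp (- b * wgt u v) <=
    k%:R * (((q * k) ^ 2)%:R / exp b).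
Proof.
move=> u_ge0 k_gt0 Dk dD uk b_ge0 qkb.
pose t := exp (- b); have t_gt0 : 0 < t := exp_gt0 _.
have t_le1 : t <= 1 by rewrite -exp0 ler_exp oppr_le0.
have expM a : exp (- b * a%:R) = t ^+ a.
  elim: a => [|a IH]; first by rewrite mulr0 exp0.
  by rewrite exprSr -IH -expD; congr exp; rewrite -addn1 natrD; ring.
have q_gt0 : (0 < q)%N by apply: ltnW; exact: finNzRing_gt1.
have layer (x : K) : 1 <= x <= k%:R ->
    exists2 a, (0 < a <= k)%N & a%:R <= x <= a.+1%:R.
  move=> /andP[x1]; elim: k {Dk uk qkb} k_gt0 => [//|[|k] IH] _ xk.
    by exists 1%N; rewrite // x1 (le_trans xk)// ler_nat.
  have [xk'|kx] := lerP x k.+1%:R; last by exists k.+1; rewrite ?ltnS ?leqnSn// xk ltW.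
  by have [//|a /andP[a0 ak] ax] := IH _ xk'; exists a; rewrite // a0 leqW.
have light v : v \in D -> v != 0 -> exp (- b * wgt u v) <=
    \sum_(1 <= a < k.+1) (if wgt u v <= a.+1%:R then t ^+ a else 0).
  move=> vD v0; have [|a /andP[a0 ak] /andP[av va]] := layer (wgt u v).
    (* The line spanned by [v] is a subcode of dimension one, so density gives [v] weight at least
       1. *)
    rewrite uk// andbT; have vL : (<[v]> <= D)%VS by rewrite -memvE.
    have := dD _ vL; rewrite dim_vline v0 => /le_trans; apply.
    rewrite /wgt (bigID (fun e => v ord0 e != 0)) /= [X in _ + X]big1 ?addr0.
      rewrite le_eqVlt; apply/orP; left; apply/eqP; apply: eq_bigl => e.
      apply/andP/idP => [[]//|ve]; split=> //; apply: mem_csupp ve; exact: memv_line.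
    move=> e /andP[/csuppP[_ /vlineP[c ->]]]; rewrite mxE negbK => ce /eqP ve.
    by rewrite ve mulr0 eqxx in ce.
  rewrite (bigD1_seq a) ?mem_index_iota ?a0 ?iota_uniq//= va.
  rewrite -[leLHS]addr0 lerD//.
    by rewrite -expM ler_exp !mulNr lerN2 ler_wpM2l.
  by apply: sumr_ge0 => i _; case: ifP => // _; rewrite exprn_ge0// ltW.
have : \sum_(v : 'rV[F]_n | (v \in D) && (v != 0)) exp (- b * wgt u v) <=
    \sum_(v : 'rV[F]_n | v \in D)
      \sum_(1 <= a < k.+1) (if wgt u v <= a.+1%:R then t ^+ a else 0).
  rewrite [leRHS](bigID (fun v => v != 0)) /= -[leLHS]addr0; apply: lerD.
    by apply: ler_sum => v /andP[vD v0]; exact: light.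
  apply: sumr_ge0 => v _; apply: sumr_ge0 => a _.
  by case: ifP => // _; rewrite exprn_ge0// ltW.
move=> /le_trans; apply; rewrite exchange_big /=.
have -> : k%:R * (((q * k) ^ 2)%:R / exp b) =
    \sum_(1 <= a < k.+1) (((q * k) ^ 2)%:R / exp b).
  by rewrite sumr_const_nat subn1 mulr_natl.
rewrite !big_nat; apply: ler_sum => a /andP[a_gt0 ak].
rewrite -big_mkcondr /=.
have -> : \sum_(v : 'rV[F]_n | (v \in D) && (wgt u v <= a.+1%:R)) t ^+ a =
    t ^+ a * (#|light_words u a.+1 D|)%:R.
  by rewrite mulr_natr -sumr_const; apply: eq_bigl => v; rewrite inE.
have := card_light_words u_ge0 (leq_maxr k a.+1) (leq_trans Dk (leq_maxl k a.+1)) dD.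
rewrite -(ler_nat K) => /(ler_wpM2l (ltW (exprn_gt0 a t_gt0)))/le_trans; apply.
(* The square comes from [a.+1 <= 2 * a]; the maximum covers the last layer, where [a.+1] exceeds
   [k]. *)
have bqk : (q ^ a.+1 * 'C(maxn k a.+1, a.+1) <= ((q * k) ^ 2) ^ a)%N.
  apply: (@leq_trans ((q * k) ^ a.+1)); last first.
    rewrite -expnM leq_pexp2l ?muln_gt0 ?q_gt0//; lia.
  rewrite expnMn leq_mul2l; apply/orP; right.
  case: (leqP a.+1 k) => ka; first by rewrite bin_leq_exp.
  by rewrite binn expn_gt0 k_gt0.
have := bqk; rewrite -(ler_nat K) => /(ler_wpM2l (ltW (exprn_gt0 a t_gt0)))/le_trans; apply.
rewrite natrX -exprMn mulrC /t expN.
set x := _ / _; have x0 : 0 <= x by rewrite divr_ge0// ltW ?exp_gt0.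
have x1 : x <= 1 by rewrite ler_pdivrMr ?mul1r ?exp_gt0.
by rewrite -(prednK a_gt0) exprS ler_piMr// exprn_ile1.
Qed.

Definition supp (v : 'rV[F]_n) : {set 'I_n} := [set e | v ord0 e != 0].

Lemma wgtE (u : 'I_n -> K) (v : 'rV[F]_n) : wgt u v = \sum_(e in supp v) u e.
Proof. by apply: eq_bigl => e; rewrite inE. Qed.

(** The bound on [exp b] pays for at most [k] levels, [k] layers on each and the growth
    [(q * k) ^ 2], and leaves failure mass 1/4 for [sampling]. *)
Lemma linear_code_sparsifier (C : {vspace 'rV[F]_n}) (w : 'I_n -> K) (eps b : K) :
  (0 < \dim C)%N -> (forall e, 0 < w e) -> 0 < eps <= 1 -> 0 < b ->
  (4 * (q * \dim C) ^ 4)%:R <= exp b ->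
  exists (S : {set 'I_n}) (w' : 'I_n -> K),
  [/\ #|S|%:R <= 2 * (8 * b / eps ^+ 2 * (\dim C)%:R + 2),
      forall e, 0 <= w' e &
      forall v, v \in C ->
        (1 - eps) * wgt w v <= \sum_(e in S | v ord0 e != 0) w' e
          <= (1 + eps) * wgt w v].
Proof.
set k := \dim C => k_gt0 w_gt0 eps01 b_gt0 qkb; have /andP[eps_gt0 eps_le1] := eps01.
have q_gt0 : (0 < q)%N by apply: ltnW; exact: finNzRing_gt1.
have [|u [L [u_ge0 [uT _] sL Lp wu]]] :=
    strength_decomposition (code_rank0 C) (@code_rankS _ _ C) (code_rank_submod C) w_gt0
      (E := setT) (d0 := 0).
  by move=> A _; rewrite mul0r sumr_ge0// => e _; rewrite ltW.
have rk E : (code_rank C E <= k)%N := code_rank_le C E.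
pose words (p : {set 'I_n} * K) :=
  enum [pred v : 'rV[F]_n | (v \in (mask p.1 @: C)%VS) && (v != 0)].
pose tests := [seq supp v | p <- L, v <- words p].
pose rho := 8 * b / eps ^+ 2.
have eps2 : 0 < eps ^+ 2 by rewrite exprn_gt0.
have rho_gt0 : 0 < rho by rewrite /rho !mulr_gt0// invr_gt0.
have rhoE : rho * eps ^+ 2 / 8 = b.
  by rewrite /rho divfK ?gt_eqF// mulrC mulKf// pnatr_eq0.
have [|S [Ssize Stests]] := sampling (tests := tests) u_ge0 rho_gt0 eps01.
  rewrite rhoE big_allpairs_dep /=.
  apply: (@le_trans _ _ (\sum_(p <- L) (k%:R * (((q * k) ^ 2)%:R / exp b)))).
    rewrite big_seq [leRHS]big_seq; apply: ler_sum => p /Lp[_ _ dp up].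
    rewrite /words big_enum_cond /=.
    under eq_bigr do rewrite -wgtE.
    under eq_bigl do rewrite andbT.
    apply: partition_bound => //; last first.
    - apply: le_trans qkb; rewrite ler_nat.
      apply: (@leq_trans ((q * k) ^ 4)); last by rewrite leq_pmull.
      by rewrite leq_pexp2l// muln_gt0 q_gt0.
    - exact: ltW.
    2: by move=> D'; apply: dense_subcode.
    2: exact: rk.
    move=> v /memv_imgP[v' _ ->].
    apply: le_trans (le_trans up _); last by rewrite ler_nat.
    rewrite wgtE [leRHS](big_setID (supp (mask p.1 v'))) /=.
    have /setIidPr -> : supp (mask p.1 v') \subset p.1.
      by apply/subsetP => e; rewrite inE maskE; case: ifP => //; rewrite eqxx.
    by rewrite lerDl sumr_ge0.
  rewrite big_const_seq count_predT iter_addr_0 -[leLHS]mulr_natl.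
  apply: (@le_trans _ _ (k%:R * (k%:R * (((q * k) ^ 2)%:R / exp b)))).
    rewrite ler_wpM2r ?ler_nat ?(leq_trans sL)//.
    by rewrite mulr_ge0// divr_ge0// ltW ?exp_gt0.
  rewrite !mulrA ler_pdivrMr ?exp_gt0// -!natrM.
  have : (k * k * (q * k) ^ 2)%:R <= (q * k)%:R ^+ 4 :> K.
    by rewrite -natrX ler_nat (expnD _ 2 2) leq_mul// -mulnn leq_mul// leq_pmull.
  move: qkb; rewrite natrM natrX; lra.
(* The strength of [e], which turns the sampled [u]-weight back into a [w]-weight. *)
pose lam e := \sum_(p <- L | e \in p.1) p.2.
have lam_ge0 e : 0 <= lam e.
  by rewrite /lam big_seq_cond; apply: sumr_ge0 => p /andP[/Lp[]].
exists S, (fun e => lam e * Num.max (u e) rho^-1); split.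
- apply: le_trans Ssize _; rewrite ler_wpM2l// lerD2r; apply: ler_wpM2l; first exact: ltW.
  have -> : \sum_e u e = \sum_(e in [set: 'I_n]) u e by apply: eq_bigl => e; rewrite inE.
  by apply: le_trans uT _; rewrite ler_nat.
- by move=> e; rewrite mulr_ge0// le_max u_ge0.
move=> v vC.
have wE : wgt w v = \sum_(p <- L) p.2 * \sum_(e in supp (mask p.1 v)) u e.
  transitivity (\sum_(e < n | v ord0 e != 0) \sum_(p <- L)
      if e \in p.1 then p.2 * u e else 0).
    apply: eq_bigr => e ve; rewrite wu ?inE//.
      rewrite add0r mulrC mulr_suml -big_mkcond; exact: eq_bigr.
    (* A coordinate of rank 0 vanishes on all of [C], so it is outside the support of [v]. *)
    move/eqP; rewrite dimv_eq0 => /eqP C0.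
    have : mask [set e] v \in (mask [set e] @: C)%VS by rewrite memv_img.
    rewrite C0 memv0 => /eqP/rowP/(_ e); rewrite maskE inE eqxx mxE => v0.
    by rewrite v0 eqxx in ve.
  rewrite exchange_big; apply: eq_bigr => p _ /=; rewrite mulr_sumr -big_mkcondr /=.
  by apply: eq_bigl => e; rewrite inE maskE; case: ifP; rewrite ?andbT// eqxx andbF.
have w'E : \sum_(e in S | v ord0 e != 0) lam e * Num.max (u e) rho^-1 =
    \sum_(p <- L) p.2 * \sum_(e in S | e \in supp (mask p.1 v)) Num.max (u e) rho^-1.
  transitivity (\sum_(e in S | v ord0 e != 0) \sum_(p <- L)
      if e \in p.1 then p.2 * Num.max (u e) rho^-1 else 0).
    by apply: eq_bigr => e ve; rewrite mulr_suml -big_mkcond.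
  rewrite exchange_big; apply: eq_bigr => p _ /=; rewrite mulr_sumr -big_mkcondr /=.
  apply: eq_bigl => e; rewrite inE maskE.
  by case: (e \in p.1); rewrite ?andbT// eqxx !andbF.
have level p : p \in L ->
    (1 - eps) * \sum_(e in supp (mask p.1 v)) u e
      <= \sum_(e in S | e \in supp (mask p.1 v)) Num.max (u e) rho^-1
      <= (1 + eps) * \sum_(e in supp (mask p.1 v)) u e.
  (* A zero restriction is not among the tests, but then all the sums are empty. *)
  move=> pL; have [v0|v0] := eqVneq (mask p.1 v) 0.
    have s0 e : (e \in supp (mask p.1 v)) = false by rewrite inE v0 mxE eqxx.
    by rewrite !big_pred0 ?mulr0 ?lexx// => e; rewrite s0 ?andbF.
  apply: Stests; apply/allpairsPdep; exists p, (mask p.1 v); split=> //.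
  by rewrite mem_enum inE memv_img// v0.
rewrite w'E wE !mulr_sumr; apply/andP; split; rewrite big_seq [leRHS]big_seq;
  apply: ler_sum => p pL; rewrite mulrCA; have [p2 _ _ _] := Lp p pL;
  by have /andP[lo hi] := level p pL; rewrite ler_wpM2l.
Qed.

End CodeSparsifier.

End Exponential.

(* Real logarithms and the final size bound *)
Local Close Scope ring_scope.
From Stdlib Require Import Reals Lra.
Require Import Defs.

Lemma ln2_gt0 : (0 < ln 2)%R.
Proof. by rewrite -ln_1; apply: ln_increasing; Lra.lra. Qed.

Lemma ln_le (x y : R) : (0 < x)%R -> (x <= y)%R -> (ln x <= ln y)%R.
Proof.
by move=> x0 [xy|->]; [apply/Rlt_le/ln_increasing | apply: Rle_refl].
Qed.

Lemma ln2_le1 : (ln 2 <= 1)%R.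
Proof.
rewrite -[X in (_ <= X)%R]ln_exp; apply: ln_le; first Lra.lra.
by have := exp_ineq1_le 1; Lra.lra.
Qed.

Lemma log2_le (x y : R) : (0 < x)%R -> (x <= y)%R -> (log2 x <= log2 y)%R.
Proof.
move=> x0 xy; apply: Rmult_le_compat_r; last exact: ln_le.
exact/Rlt_le/Rinv_0_lt_compat/ln2_gt0.
Qed.

Lemma log2_mul (x y : R) : (0 < x)%R -> (0 < y)%R -> (log2 (x * y) = log2 x + log2 y)%R.
Proof. by move=> x0 y0; rewrite /log2 ln_mult// /Rdiv Rmult_plus_distr_r. Qed.

Lemma log2_pow (x : R) (m : nat) : (0 < x)%R -> (log2 (x ^ m) = INR m * log2 x)%R.
Proof. by move=> x0; rewrite /log2 ln_pow// /Rdiv Rmult_assoc. Qed.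

Lemma log2_1 : log2 1 = 0%R.
Proof. by rewrite /log2 ln_1 /Rdiv Rmult_0_l. Qed.

Lemma log2_2 : log2 2 = 1%R.
Proof. by apply: Rinv_r; have := ln2_gt0; Lra.lra. Qed.

Lemma log2_4 : log2 4 = 2%R.
Proof.
have -> : (4 = 2 * 2)%R by Lra.lra.
rewrite log2_mul ?log2_2; Lra.lra.
Qed.

(** Here [b <= 4 * a * T], so the main term costs 64; the additive 4 is at most twice
    [k * a / eps ^ 2 * T], whence 66. *)
Lemma size_arith (k a b beta eps T : R) :
  (1 <= k)%R -> (1 <= a)%R -> (0 <= beta)%R -> (0 < eps <= 1)%R ->
  (b <= 2 + 4 * a + 4 * beta)%R -> (2 + beta <= T)%R ->
  (2 * (8 * b / eps ^ 2 * k + 2) <= 66 * (k * a / eps ^ 2) * T)%R.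
Proof.
move=> k1 a1 beta0 [eps0 eps1] bT betaT.
have y1 : (1 <= / eps ^ 2)%R.
  rewrite -Rinv_1; apply: Rinv_le_contravar; [exact: pow_lt | Lra.nra].
rewrite /Rdiv; set y := (/ eps ^ 2)%R in y1 *.
have ky : (1 <= k * y)%R by Lra.nra.
have aT : (a * (2 + beta) <= a * T)%R by apply: Rmult_le_compat_l; Lra.lra.
have baT : (b <= 4 * (a * T))%R by Lra.nra.
have aT2 : (2 <= a * T)%R by Lra.nra.
have : (k * y * b <= k * y * (4 * (a * T)))%R by apply: Rmult_le_compat_l; Lra.lra.
have : (1 * 2 <= k * y * (a * T))%R by apply: Rmult_le_compat; Lra.lra.
Lra.lra.
Qed.

Lemma ln_log2 (x : R) : ln x = (ln 2 * log2 x)%R.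
Proof. by rewrite /log2; field; have := ln2_gt0; Lra.lra. Qed.

Theorem theorem1p1 :
  exists C c : R, (0 < C)%R /\ (0 < c)%R /\
  forall (F : finFieldType) (n k : nat) (eps : R)
         (Cd : {vspace 'rV[F]_n}) (w : 'I_n -> R),
    (0 < n)%N -> (0 < k)%N -> (0 < eps < 1)%R ->
    \dim Cd = k ->
    (forall i, 0 < w i)%R ->
    exists (S : {set 'I_n}) (w' : 'I_n -> R),
      is_sparsifier Cd w eps
        (C * (INR k * log2 (INR #|F|) / (eps ^ 2))
           * Rpower (log2 (4 * INR k / eps) * log2 (log2 (4 * INR #|F|))) c)%R
        S w'.
Proof.
(* Exponent 1 is enough: the product of logarithms is at least [2 + log2 k], which absorbs the part
   of [b] depending on [k]. *)
exists 66%R, 1%R; split; first Lra.lra; split; first Lra.lra.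
move=> F n k eps Cd w _ k_gt0 [eps0 eps1] dimC w_gt0.
have k1 : (1 <= INR k)%R by apply: (le_INR 1); apply/ssrnat.leP.
have q2 : (2 <= INR #|F|)%R by apply: (le_INR 2); apply/ssrnat.leP; exact: finNzRing_gt1.
have a1 : (1 <= log2 (INR #|F|))%R by rewrite -log2_2; apply: log2_le; Lra.lra.
have beta0 : (0 <= log2 (INR k))%R by rewrite -log2_1; apply: log2_le; Lra.lra.
set a := log2 (INR #|F|) in a1 *; set beta := log2 (INR k) in beta0 *.
have T1 : (2 + beta <= log2 (4 * INR k / eps))%R.
  rewrite -log2_4 -log2_mul; try Lra.lra; apply: log2_le; first Lra.lra.
  have := Rinv_0_lt_compat eps eps0; have := Rinv_l eps.
  rewrite /Rdiv; Lra.nra.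
have T2 : (1 <= log2 (log2 (4 * INR #|F|)))%R.
  rewrite -log2_2; apply: log2_le; first Lra.lra.
  by rewrite log2_mul ?log2_4 -/a; Lra.lra.
have T12 : (2 + beta <= log2 (4 * INR k / eps) * log2 (log2 (4 * INR #|F|)))%R by Lra.nra.
rewrite Rpower_1; last Lra.lra.
set T := (_ * log2 (log2 _))%R in T12 *.
pose y := (4 * (INR #|F| * INR k) ^ 4)%R; pose b := ln y.
have qk_gt0 : (0 < INR #|F| * INR k)%R by Lra.nra.
have qk4_gt0 := pow_lt _ 4 qk_gt0.
have y4 : (4 <= y)%R.
  suff : (1 ^ 4 <= (INR #|F| * INR k) ^ 4)%R by rewrite /y pow1; Lra.lra.
  by apply: pow_incr; split; Lra.nra.
have b_gt0 : (0 < b)%R by rewrite /b -ln_1; apply: ln_increasing; Lra.lra.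
have bE : (b <= 2 + 4 * a + 4 * beta)%R.
  have -> : b = (ln 2 * (2 + 4 * a + 4 * beta))%R.
    rewrite /b ln_log2 /y log2_mul; [|Lra.lra|Lra.lra].
    rewrite log2_4 log2_pow// log2_mul; [|Lra.lra|Lra.lra].
    by rewrite -/a -/beta /=; Lra.lra.
  apply: Rle_trans (Rmult_le_compat_r _ _ _ _ ln2_le1) _; Lra.lra.
(* The abstract exponential becomes the real one, with [b] the least value meeting the bound on
   [exp b]. *)
have [|||||S [w' [Ssize w'0 Sw']]] := @linear_code_sparsifier
    R exp exp_plus (fun u => introT RleP (exp_ineq1_le u))
    F n Cd w eps b.
- by rewrite dimC.
- by move=> e; apply/RltP.
- by apply/andP; split; [apply/RltP | apply/RleP/Rlt_le].
- exact/RltP.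
- rewrite dimC /b exp_ln; last Lra.lra.
  have -> : y = (INR 4 * (INR #|F| * INR k) ^ 4)%R by rewrite /y /=; Lra.lra.
  by rewrite natrM natrX natrM -!INRE RpowE.
exists S, w'; split; [|split].
- apply: Rle_trans (size_arith k1 a1 beta0 (conj eps0 (Rlt_le _ _ eps1)) bE T12).
  have -> : (2 * (8 * b / eps ^ 2 * INR k + 2) =
             INR 2 * (INR 8 * b / eps ^ 2 * INR k + INR 2))%R by rewrite /=; Lra.lra.
  by apply/RleP; rewrite RpowE; rewrite dimC -!INRE in Ssize.
- by move=> i _; apply/RleP.
- move=> v vC; have /andP[lo hi] := Sw' v vC.
  by split; apply/RleP.
Qed.
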